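(* Let $0<\mu\le L$, let $f\in\mathcal{S}^1_{\mu,L}(\mathbb{R}^d)$ with minimizer $x^\star$, let $s\in(0,1/L]$, let $\alpha>0$ be real and let $r$ be a real number with $r>2\alpha$. Then there exists a positive integer $K$ (written $K(\alpha,r)$) such that, for every initial point $x_0=y_0\in\mathbb{R}^d$, the sequence $\{x_k\}_{k\ge 0}$ generated by NAG-$\alpha$ satisfies $$f(x_k)-f(x^\star)\le \frac{\mathcal{E}(K)}{s\,k^\alpha\left(k^\alpha+r k^{\alpha-1}\right)},\qquad \forall k\ge K,$$ where $\mathcal{E}$ is the Lyapunov function of NAG-$\alpha$ defined in the context.
   Context: $\|\cdot\|$ and $\langle\cdot,\cdot\rangle$ are the Euclidean norm and inner product on $\mathbb{R}^d$. For $0<\mu\le L$, $\mathcal{S}^1_{\mu,L}(\mathbb{R}^d)$ is the class of continuously differentiable convex functions $f:\mathbb{R}^d\to\mathbb{R}$ such that $\|\nabla f(x)-\nabla f(y)\|\le L\|x-y\|$ and $f(y)\ge f(x)+\langle\nabla f(x),y-x\rangle+\frac{\mu}{2}\|y-x\|^2$ for all $x,y\in\mathbb{R}^d$. $x^\star$ denotes the unique global minimizer of $f$. NAG-$\alpha$ with step size $s>0$ and parameters $\alpha,r$: starting from $x_0=y_0$, for $k\ge 1$, $$x_k=y_{k-1}-s\nabla f(y_{k-1}),\qquad y_k=x_k+\frac{(k-1)^\alpha}{k^\alpha+rk^{\alpha-1}}(x_k-x_{k-1}).$$ Velocity: $v_k=(x_k-x_{k-1})/\sqrt{s}$ for $k\ge1$.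 Lyapunov function, for positive integers $k$ for which the expression is defined (that is, $k\ge2$ if $\alpha<1$): $$\mathcal{E}(k)=s k^\alpha(k^\alpha+rk^{\alpha-1})\left(f(x_k)-f(x^\star)\right)+\frac12\left\|\sqrt{s}\,(k-1)^\alpha v_k+r(k-1)^{\alpha-1}(x_k-x^\star)\right\|^2.$$ *)

(* Defs.v *)
From HB Require Import structures.
From mathcomp Require Import all_boot all_order all_algebra.
From mathcomp Require Import all_classical all_reals all_analysis.

Set Implicit Arguments.
Unset Strict Implicit.
Unset Printing Implicit Defensive.

Import Order.TTheory GRing.Theory Num.Theory numFieldNormedType.Exports.

Local Open Scope classical_set_scope.
Local Open Scope ring_scope.

(* The norm that the library puts on 'rV[R]_d is the sup norm, so the Euclidean
   structure is defined here. Both norms induce the same topology, so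
   differentiability and continuity below are the usual ones. *)
Definition dotv (R : realType) (d : nat) (u v : 'rV[R]_d) : R :=
  \sum_(i < d) u 0 i * v 0 i.

Definition enorm (R : realType) (d : nat) (u : 'rV[R]_d) : R :=
  Num.sqrt (dotv u u).

Definition gradient (R : realType) (d : nat) (f : 'rV[R]_d -> R)
    (x : 'rV[R]_d) : 'rV[R]_d :=
  \row_(i < d) 'D_(delta_mx 0 i) f x.

(* The class S^1_{mu,L}(R^d) *)
Definition smooth_strongly_convex (R : realType) (d : nat) (mu L : R)
    (f : 'rV[R]_d -> R) : Prop :=
  [/\ (forall x, differentiable f x) /\ continuous (gradient f),
      convex_function [set: 'rV[R]_d] f,
      forall x y,
        enorm (gradient f x - gradient f y) <= L * enorm (x - y)
    & forall x y,
        f x + dotv (gradient f x) (y - x) + mu / 2 * enorm (y - x) ^+ 2 <= f y].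

Definition global_minimizer (R : realType) (d : nat) (f : 'rV[R]_d -> R)
    (xstar : 'rV[R]_d) : Prop :=
  forall y, f xstar <= f y.

(* [powR] follows 0 `^ 0 = 1 and 0 `^ p = 0 for p != 0. At k = 1, the momentum
   numerator (k - 1)^alpha is thus 0 for alpha > 0. *)
Definition nag_alpha (R : realType) (d : nat) (f : 'rV[R]_d -> R)
    (s alpha r : R) (x y : nat -> 'rV[R]_d) : Prop :=
  x 0%N = y 0%N /\
  forall k : nat, (1 <= k)%N ->
    x k = y k.-1 - s *: gradient f (y k.-1) /\
    y k = x k + (k.-1%:R `^ alpha
                 / (k%:R `^ alpha + r * k%:R `^ (alpha - 1)))
                *: (x k - x k.-1).

Definition velocity (R : realType) (d : nat) (s : R) (x : nat -> 'rV[R]_d)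
    (k : nat) : 'rV[R]_d :=
  (Num.sqrt s)^-1 *: (x k - x k.-1).

(* Meaningful for k >= 1, and only for k >= 2 if alpha < 1: the factor
   (k - 1)^(alpha - 1) is then undefined at k = 1, where [powR] returns 0. *)
Definition lyapunov (R : realType) (d : nat) (f : 'rV[R]_d -> R)
    (xstar : 'rV[R]_d) (s alpha r : R) (x : nat -> 'rV[R]_d) (k : nat) : R :=
  s * k%:R `^ alpha * (k%:R `^ alpha + r * k%:R `^ (alpha - 1))
    * (f (x k) - f xstar)
  + 2^-1 * enorm ((Num.sqrt s * k.-1%:R `^ alpha) *: velocity s x k
                  + (r * k.-1%:R `^ (alpha - 1)) *: (x k - xstar)) ^+ 2.

(* Main.v *)
Require Import Defs.
From HB Require Import structures.
From mathcomp Require Import all_boot all_order all_algebra.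
From mathcomp Require Import all_classical all_reals all_analysis.
From mathcomp Require Import ring lra.

Set Implicit Arguments.
Unset Strict Implicit.
Unset Printing Implicit Defensive.

Import Order.TTheory GRing.Theory Num.Theory numFieldNormedType.Exports.

Local Open Scope classical_set_scope.
Local Open Scope ring_scope.

(** Write A_k = k^alpha, B_k = r k^(alpha-1), D_k = A_k + B_k, and let
    w_k = A_(k-1) (x_k - x_(k-1)) + B_(k-1) (x_k - x^star), the vector whose
    half squared norm is the kinetic part of the Lyapunov function.  The theorem
    holds because the Lyapunov function is eventually nonincreasing; its
    potential part alone then gives the rate.

    Fix k and put p = y_k - x_k, q = y_k - x^star, g = grad f(y_k) and
    u = A_k p + B_k q.  The momentum coefficient A_(k-1) / D_k is exactly the
    one for which
      w_(k+1) = u - s D_k g   and   w_k = u - (B_k - B_(k-1)) (q - p).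
    The gradient step inequality [gradient_step], used at z = x_k with weight
    A_k and at z = x^star with weight B_k, bounds <g, u> from below, and
    [energy_step] turns this into a decrease of the energy up to two errors.

    - The gap f(x_(k+1)) - f(x^star) comes with the weight D_k^2, whereas the
      Lyapunov function weighs it by A_(k+1) D_(k+1).  To leading order
      A_(k+1) D_(k+1) - D_k^2 is (2 alpha - r) k^(2 alpha - 1), so the
      discrepancy eventually has the right sign because r > 2 alpha
      ([near_weight_le]).
    - The drift B_k - B_(k-1) of the friction coefficient produces a term that
      need not have a sign when alpha <> 1.  It is o(B_k) ([near_powR_pred]),
      while strong convexity supplies the negative quadratic terms
      - s mu D_k (A_k |p|^2 + B_k |q|^2) / 2, which absorb it
      once k is large.

    The only smoothness input is the quadratic upper bound
    [quadratic_upper_bound].  It is derived from the Lipschitz gradient and the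
    convexity lower bound by telescoping along a subdivided segment, which
    replaces integration of the gradient along the segment. *)

(** * The Euclidean inner product *)

Lemma dotvC (R : realType) (d : nat) (u v : 'rV[R]_d) : dotv u v = dotv v u.
Proof. by apply: eq_bigr => i _; rewrite mulrC. Qed.

Lemma dotvDl (R : realType) (d : nat) (u v w : 'rV[R]_d) :
  dotv (u + v) w = dotv u w + dotv v w.
Proof. by rewrite -big_split; apply: eq_bigr => i _; rewrite mxE mulrDl. Qed.

Lemma dotvZl (R : realType) (d : nat) (a : R) (u v : 'rV[R]_d) :
  dotv (a *: u) v = a * dotv u v.
Proof. by rewrite mulr_sumr; apply: eq_bigr => i _; rewrite mxE mulrA. Qed.

Lemma dotvNl (R : realType) (d : nat) (u v : 'rV[R]_d) :
  dotv (- u) v = - dotv u v.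
Proof. by rewrite -scaleN1r dotvZl mulN1r. Qed.

Lemma dotvDr (R : realType) (d : nat) (u v w : 'rV[R]_d) :
  dotv w (u + v) = dotv w u + dotv w v.
Proof. by rewrite dotvC dotvDl !(dotvC w). Qed.

Lemma dotvZr (R : realType) (d : nat) (a : R) (u v : 'rV[R]_d) :
  dotv u (a *: v) = a * dotv u v.
Proof. by rewrite dotvC dotvZl dotvC. Qed.

Lemma dotvNr (R : realType) (d : nat) (u v : 'rV[R]_d) :
  dotv u (- v) = - dotv u v.
Proof. by rewrite dotvC dotvNl dotvC. Qed.

Definition dotvE := (dotvDl, dotvDr, dotvZl, dotvZr, dotvNl, dotvNr).

Lemma dotvv_ge0 (R : realType) (d : nat) (u : 'rV[R]_d) : 0 <= dotv u u.
Proof. by apply: sumr_ge0 => i _; rewrite -expr2 sqr_ge0. Qed.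

Lemma enorm_sqr (R : realType) (d : nat) (u : 'rV[R]_d) :
  enorm u ^+ 2 = dotv u u.
Proof. by rewrite sqr_sqrtr ?dotvv_ge0. Qed.

Lemma dotv_subr_sqr (R : realType) (d : nat) (u v : 'rV[R]_d) :
  dotv (u - v) (u - v) = dotv u u - 2 * dotv u v + dotv v v.
Proof. by rewrite !dotvE (dotvC v u); ring. Qed.

(** * First-order inequalities *)

(** Along a ray, the Lipschitz bound gives this without a square root: expand
    0 <= |h - g + L t v|^2, where g and h are the two gradients and
    |h - g|^2 <= (L t)^2 |v|^2. *)
Lemma dotv_gradient_ray (R : realType) (d : nat) (mu L : R)
    (f : 'rV[R]_d -> R) (y v : 'rV[R]_d) (t : R) :
  0 < L -> 0 < t -> smooth_strongly_convex mu L f ->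
  dotv (gradient f y) v - L * t * dotv v v
    <= dotv (gradient f (y - t *: v)) v.
Proof.
move=> L0 t0 [_ _ lip _].
set g := gradient f y; set h := gradient f _.
have /(lerXn2r 2) : enorm (h - g) <= L * enorm (y - t *: v - y) by apply: lip.
rewrite !nnegrE sqrtr_ge0 mulr_ge0 ?sqrtr_ge0 ?(ltW L0) // => /(_ isT isT).
rewrite exprMn !enorm_sqr addrAC subrr add0r -scaleNr dotvZl dotvZr => le_hg.
have c0 : 0 < L * t by rewrite mulr_gt0.
have := dotvv_ge0 (h - g + (L * t) *: v).
move: le_hg; rewrite !dotvE (dotvC g h) (dotvC v h) (dotvC v g) => le_hg sq_ge0.
rewrite -subr_ge0 -(pmulr_rge0 _ c0).
by nra.
Qed.

(** The convexity lower bound based at the far end of each of [n] steps of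
    length [t] bounds the decrease of [f] on that step from below by the slope
    there, and [dotv_gradient_ray] compares this slope with the one at [y]; the
    factor n (n + 1) / 2 is the sum 1 + ... + n of the resulting errors.
    This is a Riemann sum for the integral of the slope. *)
Lemma descent_partition (R : realType) (d : nat) (mu L : R)
    (f : 'rV[R]_d -> R) (y v : 'rV[R]_d) (t : R) (n : nat) :
  0 <= mu -> 0 < L -> 0 < t -> smooth_strongly_convex mu L f ->
  f (y - (n%:R * t) *: v)
    <= f y - n%:R * t * dotv (gradient f y) v
       + L * t ^+ 2 / 2 * (n%:R * (n%:R + 1)) * dotv v v.
Proof.
move=> mu0 L0 t0 hf; elim: n => [|n IHn].
  by rewrite mulr0n !mul0r scale0r !subr0 mulr0 mul0r addr0.
have := dotv_gradient_ray y v L0 (mulr_gt0 (ltr0Sn R n) t0) hf.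
case: hf => _ _ _ /(_ (y - (n.+1%:R * t) *: v) (y - (n%:R * t) *: v)).
set z := y - (n.+1%:R * t) *: v; set w := y - (n%:R * t) *: v.
have -> : w - z = t *: v.
  by apply/rowP => i; rewrite /w /z !mxE -natr1; ring.
rewrite enorm_sqr !dotvE => lower grad_le.
have : 0 <= mu / 2 * (t * (t * dotv v v)).
  by rewrite !mulr_ge0 ?dotvv_ge0 ?invr_ge0 // ltW.
have := ler_wpM2l (ltW t0) grad_le.
move: IHn lower; rewrite -/w -(natr1 n); lra.
Qed.

(** Refining the partition of the segment into [n] equal steps leaves an excess
    of order 1/n over the claimed bound. *)
Lemma quadratic_upper_bound (R : realType) (d : nat) (mu L : R)
    (f : 'rV[R]_d -> R) (y v : 'rV[R]_d) (t : R) :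
  0 <= mu -> 0 < L -> 0 < t -> smooth_strongly_convex mu L f ->
  f (y - t *: v)
    <= f y - t * dotv (gradient f y) v + L * t ^+ 2 / 2 * dotv v v.
Proof.
move=> mu0 L0 t0 hf; apply/ler_addgt0Pr => e e0.
set c := L * t ^+ 2 / 2 * dotv v v.
(* n.+1 > c / e, so that the excess c / n.+1 is at most e. *)
pose n := Num.trunc (c / e).
have n0 : (0 : R) < n.+1%:R by rewrite ltr0Sn.
have := descent_partition y v n.+1 mu0 L0 (divr_gt0 t0 n0) hf.
have -> : n.+1%:R * (t / n.+1%:R) = t by field; rewrite gt_eqF.
have -> : L * (t / n.+1%:R) ^+ 2 / 2 * (n.+1%:R * (n.+1%:R + 1)) * dotv v v
    = c + c / n.+1%:R by rewrite /c; field; rewrite gt_eqF.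
have : c / n.+1%:R <= e.
  by rewrite ler_pdivrMr // mulrC -ler_pdivrMr // ltW // truncnS_gt.
by move: (c / n.+1%:R) => q; lra.
Qed.

(** With step s <= 1 / L the step from [y] lowers [f] by at least s/2 |g|^2
    ([quadratic_upper_bound]), while strong convexity bounds f(y) in terms of
    f(z). *)
Lemma gradient_step (R : realType) (d : nat) (mu L s : R)
    (f : 'rV[R]_d -> R) (y z : 'rV[R]_d) :
  0 <= mu -> 0 < L -> 0 < s -> s <= 1 / L -> smooth_strongly_convex mu L f ->
  f (y - s *: gradient f y)
    <= f z + dotv (gradient f y) (y - z)
       - s / 2 * dotv (gradient f y) (gradient f y)
       - mu / 2 * dotv (y - z) (y - z).
Proof.
move=> mu0 L0 s0; rewrite ler_pdivlMr // => sL hf.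
have := quadratic_upper_bound y (gradient f y) mu0 L0 s0 hf.
case: hf => _ _ _ /(_ y z); rewrite enorm_sqr -(opprB y z) !dotvE.
set G := dotv (gradient f y) (gradient f y).
have : (s * L) * (s * G) <= 1 * (s * G).
  by rewrite ler_wpM2r // mulr_ge0 ?dotvv_ge0 // ltW.
by lra.
Qed.

(** * One step of the energy estimate *)

(** Here [p], [q] are the displacements of the extrapolated point from the
    current iterate and from the minimizer, and [g] is its gradient.
    Multiplying the two gradient step inequalities by s (A + B) A and
    s (A + B) B and adding them gives s (A + B)^2 (fnext - fmin) on the left and
    the cross term of |u - s (A + B) g|^2 on the right; the terms in |g|^2
    cancel exactly.  What remains is the cross term delta <u, q - p>, absorbed
    by the strong convexity terms. *)
Lemma energy_step (R : realType) (d : nat) (p q g u : 'rV[R]_d)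
    (A B C delta mu s fx fnext fmin : R) :
  0 < A -> 0 < B -> 0 < s -> C <= (A + B) ^+ 2 ->
  4 * `|delta| <= s * mu * A -> 4 * `|delta| <= s * mu * B ->
  fmin <= fnext ->
  fnext <= fx + dotv g p - s / 2 * dotv g g - mu / 2 * dotv p p ->
  fnext <= fmin + dotv g q - s / 2 * dotv g g - mu / 2 * dotv q q ->
  u = A *: p + B *: q ->
  s * C * (fnext - fmin)
    + 2^-1 * dotv (u - (s * (A + B)) *: g) (u - (s * (A + B)) *: g)
  <= s * (A * (A + B)) * (fx - fmin)
    + 2^-1 * dotv (u - delta *: (q - p)) (u - delta *: (q - p)).
Proof.
move=> A0 B0 s0 leC dA dB fmin_le hx hmin def_u.
have D0 : 0 < A + B by rewrite addr_gt0.
have decC : 0 <= s * ((A + B) ^+ 2 - C) * (fnext - fmin).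
  by rewrite mulr_ge0 ?subr_ge0 // mulr_ge0 ?subr_ge0 // ltW.
have descx := ler_wpM2l (ltW (mulr_gt0 (mulr_gt0 s0 D0) A0)) hx.
have descmin := ler_wpM2l (ltW (mulr_gt0 (mulr_gt0 s0 D0) B0)) hmin.
(* |<u, q - p>| <= 2 (A + B) (|p|^2 + |q|^2) by 2 |<p, q>| <= |p|^2 + |q|^2;
   the factor 4 in the bounds on delta matches this 2 and the 1/2 of mu / 2. *)
have drift : delta * dotv u (q - p)
    <= s * mu / 2 * (A + B) * (A * dotv p p + B * dotv q q).
  have := dotvv_ge0 (q - p); have := dotvv_ge0 (q + p).
  have := dotvv_ge0 p; have := dotvv_ge0 q.
  rewrite def_u !dotvE (dotvC q p).
  set P := dotv p p; set Q := dotv q q; set pq := dotv p q => Q0 P0 ge_pq le_pq.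
  set w := (w in delta * w).
  have bound : `|w| <= 2 * (A + B) * (P + Q).
    by rewrite ler_norml /w; apply/andP; split; nra.
  apply: (le_trans (ler_norm _)); rewrite normrM.
  have := ler_wpM2l (normr_ge0 delta) bound.
  have := ler_wpM2r (mulr_ge0 (ltW D0) P0) dA.
  have := ler_wpM2r (mulr_ge0 (ltW D0) Q0) dB.
  by lra.
have := dotvv_ge0 (delta *: (q - p)).
move: drift descx descmin decC.
rewrite !dotv_subr_sqr !(dotvZl, dotvZr) (dotvC u g).
have -> : dotv g u = A * dotv g p + B * dotv g q by rewrite def_u !dotvE.
by lra.
Qed.

(** * Asymptotics of the coefficients *)

(** The left side is at most exp(2 alpha t) <= 1 / (1 - 2 alpha t), and the
    smallness condition says exactly that (1 + r t) (1 - 2 alpha t) >= 1. *)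
Lemma powR1D_sqr_le (R : realType) (alpha r t : R) :
  0 < alpha -> 0 < t -> 2 * alpha * r * t <= r - 2 * alpha ->
  2 * alpha * t < 1 ->
  ((1 + t) `^ alpha) ^+ 2 <= 1 + r * t.
Proof.
move=> alpha0 t0 small small1.
have t1 : 0 < 1 + t by rewrite addr_gt0.
have -> : ((1 + t) `^ alpha) ^+ 2 = expR (2 * alpha * ln (1 + t)).
  by rewrite /powR gt_eqF // -expRM_natl mulrA.
apply: (@le_trans _ _ (expR (2 * alpha * t))).
  rewrite ler_expR ler_wpM2l ?mulr_ge0 ?(ltW alpha0) // le_ln1Dx //.
  by apply: lt_trans t0; rewrite ltrN10.
have pos : 0 < 1 - 2 * alpha * t by rewrite subr_gt0.
rewrite -(ler_pM2r pos) (@le_trans _ _ 1) //.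
  rewrite -[leRHS](expRxMexpNx_1 (2 * alpha * t)) ler_wpM2l ?expR_ge0 //.
  by apply: le_trans (expR_ge1Dx _).
have := ler_wpM2r (ltW t0) small.
by lra.
Qed.

Lemma powR_sub1 (R : realType) (x a : R) : 0 < x -> x `^ (a - 1) = x `^ a / x.
Proof.
move=> x0; rewrite powRB; last by rewrite (gt_eqF x0) implybT.
by rewrite powRr1 // ltW.
Qed.

(** With t = 1/k, dividing by k^(2 alpha) reduces the claim to
    (1 + t)^(2 alpha) (1 + r / (k + 1)) <= (1 + r t)^2.  One factor 1 + r t
    dominates 1 + r / (k + 1); the other dominates (1 + t)^(2 alpha) for small
    t because r > 2 alpha. *)
Lemma near_weight_le (R : realType) (alpha r : R) :
  0 < alpha -> 2 * alpha < r ->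
  \forall k \near \oo,
    k.+1%:R `^ alpha * (k.+1%:R `^ alpha + r * k.+1%:R `^ (alpha - 1))
      <= (k%:R `^ alpha + r * k%:R `^ (alpha - 1)) ^+ 2 :> R.
Proof.
move=> alpha0 lt_r.
near=> k.
have k0 : 0 < k%:R :> R.
  by apply: lt_le_trans (_ : 1 <= _) => //; near: k; exact: nbhs_infty_ger.
have r0 : 0 < r by lra.
have gap0 : 0 < r - 2 * alpha by lra.
have small : 2 * alpha * r / k%:R <= r - 2 * alpha.
  rewrite ler_pdivrMr // -ler_pdivrMl //.
  by near: k; exact: nbhs_infty_ger.
have small1 : 2 * alpha / k%:R < 1.
  rewrite ltr_pdivrMr // mul1r (@lt_le_trans _ _ (2 * alpha + 1)) ?ltrDl //.
  by near: k; exact: nbhs_infty_ger.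
have ik0 : 0 < k%:R^-1 :> R by rewrite invr_gt0.
have c2 := powR1D_sqr_le alpha0 ik0 small small1.
have kS0 : 0 < k.+1%:R :> R by [].
rewrite !powR_sub1 //.
have -> : k.+1%:R `^ alpha = k%:R `^ alpha * (1 + k%:R^-1) `^ alpha :> R.
  rewrite -powRM ?addr_ge0 ?(ltW k0) ?(ltW ik0) //.
  by rewrite mulrDr mulr1 divff ?gt_eqF // -natr1.
move: c2; set c := (1 + _) `^ alpha => c2.
have c_ge0 : 0 <= c by exact: powR_ge0.
set a := k%:R `^ alpha.
have -> : a * c * (a * c + r * (a * c / k.+1%:R))
    = a ^+ 2 * (c ^+ 2 * (1 + r / k.+1%:R)).
  by field; rewrite gt_eqF.
have -> : (a + r * (a / k%:R)) ^+ 2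
    = a ^+ 2 * ((1 + r / k%:R) * (1 + r / k%:R)).
  by field; rewrite gt_eqF.
have rk_ge0 : 0 <= r / k.+1%:R by rewrite divr_ge0 // ltW.
rewrite ler_wpM2l ?sqr_ge0 // ler_pM ?sqr_ge0 ?addr_ge0 //.
rewrite lerD2l ler_pM2l // lef_pV2 ?posrE //.
by rewrite ler_nat.
Unshelve. all: by end_near. Qed.

(** The ratio (k - 1)^a / k^a = (1 - 1/k)^a tends to 1 because x |-> x^a is
    continuous at 1, whatever the sign of [a]. *)
Lemma near_powR_pred (R : realType) (a e : R) : 0 < e ->
  \forall k \near \oo, `|k%:R `^ a - k.-1%:R `^ a| <= e * k%:R `^ a :> R.
Proof.
move=> e0.
have : {for (1 : R), continuous ((@powR R)^~ a)}.
  apply: differentiable_continuous; apply/derivable1_diffP.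
  by apply: derivable_powR; rewrite in_itv /= ltr01.
move=> /cvgrPdist_le /(_ e e0) /nbhs_ballP[D /= D0 ballD].
near=> k.
have k0 : 0 < k%:R :> R.
  by apply: lt_le_trans (_ : 1 <= _) => //; near: k; exact: nbhs_infty_ger.
have k1 : 1 <= k%:R :> R by near: k; exact: nbhs_infty_ger.
have -> : k.-1%:R = k%:R * (1 - k%:R^-1) :> R.
  rewrite mulrBr mulr1 divff ?gt_eqF // -subn1 natrB //.
  by rewrite -(ler_nat R).
have k_inv : k%:R^-1 <= 1 :> R by rewrite invf_le1.
rewrite powRM ?ler0n ?subr_ge0 // -[X in `|X - _|]mulr1 -mulrBr normrM.
rewrite ger0_norm ?powR_ge0 // mulrC ler_wpM2r ?powR_ge0 //.
have /= := ballD (1 - k%:R^-1); rewrite powR1; apply.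
rewrite -ball_normE /= opprB addrC subrK ger0_norm ?invr_ge0 //.
rewrite invf_plt ?posrE // (@lt_le_trans _ _ (D^-1 + 1)) ?ltrDl //.
by near: k; exact: nbhs_infty_ger.
Unshelve. all: by end_near. Qed.

(** * Monotonicity of the Lyapunov function *)

Lemma lyapunovE (R : realType) (d : nat) (f : 'rV[R]_d -> R)
    (xstar : 'rV[R]_d) (s alpha r : R) (x : nat -> 'rV[R]_d) (k : nat) :
  0 < s ->
  let w := k.-1%:R `^ alpha *: (x k - x k.-1)
           + (r * k.-1%:R `^ (alpha - 1)) *: (x k - xstar) in
  lyapunov f xstar s alpha r x k
  = s * (k%:R `^ alpha * (k%:R `^ alpha + r * k%:R `^ (alpha - 1)))
    * (f (x k) - f xstar) + 2^-1 * dotv w w.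
Proof.
move=> s0 w; rewrite /lyapunov /velocity enorm_sqr scalerA.
rewrite (mulrAC (Num.sqrt s)).
by rewrite divff ?gt_eqF ?sqrtr_gt0 // mul1r !mulrA.
Qed.

(** The recursion puts both kinetic vectors in the form required by
    [energy_step] with delta = B_k - B_(k-1).  The condition r <= k means
    B_k <= A_k, so that the drift, small relative to B_k, is also small relative
    to A_k. *)
Lemma lyapunov_step (R : realType) (d : nat) (mu L : R) (f : 'rV[R]_d -> R)
    (xstar : 'rV[R]_d) (s alpha r : R) (x y : nat -> 'rV[R]_d) (k : nat) :
  0 < mu -> 0 < L -> smooth_strongly_convex mu L f ->
  global_minimizer f xstar -> 0 < s -> s <= 1 / L -> 0 < r ->
  nag_alpha f s alpha r x y -> (0 < k)%N -> r <= k%:R ->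
  k.+1%:R `^ alpha * (k.+1%:R `^ alpha + r * k.+1%:R `^ (alpha - 1))
    <= (k%:R `^ alpha + r * k%:R `^ (alpha - 1)) ^+ 2 ->
  `|k%:R `^ (alpha - 1) - k.-1%:R `^ (alpha - 1)|
    <= s * mu / 4 * k%:R `^ (alpha - 1) ->
  lyapunov f xstar s alpha r x k.+1 <= lyapunov f xstar s alpha r x k.
Proof.
move=> mu0 L0 hf hmin s0 sL r0 [_ nag] k_gt0 le_rk weight drift.
have k0 : 0 < k%:R :> R by rewrite ltr0n.
have [_ momentum] := nag k k_gt0.
have [/= next _] := nag k.+1 isT.
rewrite !lyapunovE //= next.
set g := gradient f (y k); set p := y k - x k; set q := y k - xstar.
move: drift weight momentum.
set A := k%:R `^ alpha; set A' := k.-1%:R `^ alpha.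
set b := k%:R `^ (alpha - 1); set b' := k.-1%:R `^ (alpha - 1).
move=> drift weight momentum.
have A0 : 0 < A by rewrite powR_gt0.
have b0 : 0 < b by rewrite powR_gt0.
have B0 : 0 < r * b by rewrite mulr_gt0.
have le_BA : r * b <= A.
  rewrite /b powR_sub1 // -/A mulrA mulrAC.
  by rewrite ler_piMl ?(ltW A0) // ler_pdivrMr ?mul1r.
have velocityE : A' *: (x k - x k.-1) = (A + r * b) *: p.
  rewrite /p momentum addrAC subrr add0r scalerA mulrC divfK //.
  by rewrite gt_eqF // addr_gt0.
have driftB : 4 * `|r * b - r * b'| <= s * mu * (r * b).
  rewrite -mulrBr normrM (gtr0_norm r0).
  by have := ler_wpM2l (ltW r0) drift; lra.
have driftA : 4 * `|r * b - r * b'| <= s * mu * A.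
  by apply: le_trans driftB _; rewrite ler_wpM2l // mulr_ge0 ?ltW.
have := energy_step A0 B0 s0 weight driftA driftB (hmin _)
  (gradient_step (y k) (x k) (ltW mu0) L0 s0 sL hf)
  (gradient_step (y k) xstar (ltW mu0) L0 s0 sL hf) erefl.
rewrite -/g -/p -/q velocityE.
have -> : (A + r * b) *: p + (r * b') *: (x k - xstar)
    = A *: p + (r * b) *: q - (r * b - r * b') *: (q - p).
  by apply/rowP => i; rewrite /p /q !mxE; ring.
have -> // : A *: (y k - s *: g - x k) + (r * b) *: (y k - s *: g - xstar)
    = A *: p + (r * b) *: q - (s * (A + r * b)) *: g.
by apply/rowP => i; rewrite /p /q !mxE; ring.
Qed.

Theorem theorem3p1 (R : realType) (d : nat) (mu L : R)
    (hmu : 0 < mu) (hmuL : mu <= L)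
    (f : 'rV[R]_d -> R) (hf : smooth_strongly_convex mu L f)
    (xstar : 'rV[R]_d) (hxstar : global_minimizer f xstar)
    (s : R) (hs0 : 0 < s) (hsL : s <= 1 / L)
    (alpha : R) (halpha : 0 < alpha)
    (r : R) (hr : 2 * alpha < r) :
  exists K : nat,
    [/\ (0 < K)%N,
        alpha < 1 -> (2 <= K)%N
      & forall x y : nat -> 'rV[R]_d,
          nag_alpha f s alpha r x y ->
          forall k : nat, (K <= k)%N ->
            f (x k) - f xstar
            <= lyapunov f xstar s alpha r x K
               / (s * k%:R `^ alpha
                  * (k%:R `^ alpha + r * k%:R `^ (alpha - 1)))].
Proof.
have L0 : 0 < L by exact: lt_le_trans hmuL.
have r0 : 0 < r by lra.
have e0 : 0 < s * mu / 4 by rewrite !mulr_gt0.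
have [N _ tail] : \forall k \near \oo, [/\ r <= k%:R,
    k.+1%:R `^ alpha * (k.+1%:R `^ alpha + r * k.+1%:R `^ (alpha - 1))
      <= (k%:R `^ alpha + r * k%:R `^ (alpha - 1)) ^+ 2
    & `|k%:R `^ (alpha - 1) - k.-1%:R `^ (alpha - 1)|
      <= s * mu / 4 * k%:R `^ (alpha - 1)].
  near=> k; split; near: k.
  - exact: nbhs_infty_ger.
  - exact: near_weight_le.
  - exact: near_powR_pred.
(* From the index 2 on, (k - 1)^(alpha - 1) is a genuine power. *)
exists N.+2; split=> // x y nag k le_Kk.
have decr : lyapunov f xstar s alpha r x k <= lyapunov f xstar s alpha r x N.+2.
  rewrite -(subnK le_Kk); elim: (k - N.+2)%N => [|n IHn] //.
  rewrite addSn; apply: le_trans IHn.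
  have [|le_r weight drift] := tail (n + N.+2)%N.
    by rewrite /= (leq_trans _ (leq_addl _ _)) // -addn2 leq_addr.
  apply: (lyapunov_step hmu L0 hf hxstar hs0 hsL r0 nag) => //.
  by rewrite addnS.
have k0 : 0 < k%:R :> R by rewrite ltr0n (leq_trans _ le_Kk).
rewrite ler_pdivlMr; last first.
  by rewrite !mulr_gt0 ?addr_gt0 ?mulr_gt0 ?powR_gt0.
apply: le_trans decr; rewrite lyapunovE //= mulrC -mulrA -[leLHS]addr0 lerD2l.
by rewrite mulr_ge0 ?invr_ge0 ?dotvv_ge0.
Unshelve. all: by end_near. Qed.
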